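(* Let $p\ge 3$ be a prime and let $\alpha,\beta\ge 1$ be integers. (i) If $\bar a_{2\alpha}(2p)\equiv 0\pmod 2$, then for all integers $n,k\ge 0$ with $p\nmid(2n+1)$, $$\bar a_{2\alpha}\left(4p^{2k+1}n+2p^{2k+1}\right)\equiv 0\pmod 4.$$ (ii) If $\bar a_{2\beta+1}(2p)\equiv 0\pmod 2$, then for all integers $n,k\ge 0$ with $p\nmid(2n+1)$, $$\bar a_{2\beta+1}\left(4p^{2k+1}n+2p^{2k+1}\right)\equiv 0\pmod 8.$$
   Context: For integers $\ell\ge1$ write $f_\ell=\prod_{j\ge 1}(1-q^{\ell j})$. For a positive integer $s$, $\bar a_s(n)$ denotes the number of partitions of $n$ in which each odd part occurs in one of $s$ colors and the first occurrence of each part (parts of the same size but different colors being distinct) may be overlined. Equivalently, $$\sum_{n\ge0}\bar a_s(n)q^n=\frac{f_2^{3s-2}}{f_1^{2s}f_4^{s-1}}.$$ *)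

(* Defs.v *)
From mathcomp Require Import all_boot.

Set Implicit Arguments.
Unset Strict Implicit.
Unset Printing Implicit Defensive.

(* A part is a size together with a colour.  An even part comes in a single
   colour, which is colour 0; so s is meant to be positive. *)
Definition is_part (s n : nat) (u : 'I_n.+1 * 'I_s) : bool :=
  (0 < u.1) && (odd u.1 || (u.2 == 0 :> nat)).

(* A partition of n is given by the multiplicity m u of every part u, and o is
   the set of the parts whose first occurrence is overlined.  Sizes and
   multiplicities in a partition of n are at most n, so taking them in 'I_n.+1
   loses nothing. *)
Definition is_overpartition (s n : nat)
    (m : {ffun 'I_n.+1 * 'I_s -> 'I_n.+1}) (o : {set 'I_n.+1 * 'I_s}) : bool :=
  [&& [forall u, (0 < m u) ==> is_part u],
      [forall u in o, 0 < m u]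
    & \sum_(u : 'I_n.+1 * 'I_s) u.1 * m u == n].

Definition abar (s n : nat) : nat :=
  #|[set x : {ffun 'I_n.+1 * 'I_s -> 'I_n.+1} * {set 'I_n.+1 * 'I_s}
       | is_overpartition x.1 x.2]|.

(* Main.v *)
(** Write phi(x) for the sum of (-1)^j x^(j^2) over all integers j.  Gauss'
    identity says that 1/phi(q) is the product of the (1 + q^j)/(1 - q^j), so
    that the generating function of abar s is phi(q^2)^(s-1) / phi(q)^s.
    Since phi = 1 + 2X with X supported on squares, phi^2 = 1 modulo 4, and
    phi(q)^2 = 1 + 4 (X(q) + X(q^2)), phi^4 = 1 modulo 8.  Hence the generating
    function is phi(q^2) modulo 4 when s is even, and modulo 8, when s is odd,
    it is supported on exponents j^2, 2j^2 and 4j^2.  The p-adic valuation of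
    2 p^(2k+1) (2n+1) is odd, so this number is not of these forms. *)

Require Import Defs.
From mathcomp Require Import all_boot.
From mathcomp Require Import all_algebra.
From mathcomp Require Import ring zify.

Set Implicit Arguments.
Unset Strict Implicit.
Unset Printing Implicit Defensive.

Import GRing.Theory.
Local Open Scope ring_scope.

(** * Gauss' identity for nilpotent x, and powers of phi modulo 4 and 8 *)

Section Theta.
Variable S : comNzRingType.
Implicit Types x y : S.

(** The X of phi = 1 + 2X, cut after j = n. If x^(n+1) = 0, nothing is lost: j > n gives j^2 > n. *)
Definition squares n x : S := \sum_(1 <= j < n.+1) (-1) ^+ j * x ^+ (j ^ 2).
Definition theta n x : S := 1 + 2 * squares n x.

Lemma squaresS n x :
  squares n.+1 x = squares n x + (-1) ^+ n.+1 * x ^+ (n.+1 ^ 2).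
Proof. by rewrite /squares big_nat_recr. Qed.

(* Shanks' finite form of Gauss' identity, with the denominators cleared.  Every
   correction term is divisible by x^(n+1), so it dies in a ring truncated at
   that order. *)
Definition shanks_term n x s : S :=
  (-1) ^+ s.+1 * \prod_(s.+2 <= j < n.+1) (1 - x ^+ j)
    * \prod_(1 <= j < s.+1) (1 + x ^+ j) * x ^+ (s.+1 * n.+1).

Lemma theta_mul_prod n x :
  theta n x * \prod_(1 <= j < n.+1) (1 + x ^+ j) =
  \prod_(1 <= j < n.+1) (1 - x ^+ j) + 2 * \sum_(0 <= s < n) shanks_term n x s.
Proof.
elim: n => [|n IHn].
  by rewrite /theta /squares !big_geq // !mulr0 !addr0 mulr1.
pose h s : S := (-1) ^+ s.+1 * \prod_(s.+1 <= j < n.+1) (1 - x ^+ j)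
    * \prod_(1 <= j < s.+1) (1 + x ^+ j) * x ^+ (s.+1 * n.+1).
(* The recurrence in n telescopes in s with certificate h. *)
have step s : (0 <= s < n)%N ->
    shanks_term n.+1 x s - (1 + x ^+ n.+1) * shanks_term n x s
    = h s.+1 - h s.
  case/andP=> _ lt_sn; rewrite /shanks_term /h.
  rewrite (@big_nat_recr _ _ _ n.+1 s.+2) //= (@big_ltn _ _ _ s.+1) ?ltnS //.
  rewrite (@big_nat_recr _ _ _ s.+1 1) //=.
  have -> : (s.+1 * n.+2 = s.+1 * n.+1 + s.+1)%N by rewrite mulnS addnC.
  rewrite [(s.+2 * n.+1)%N]mulSn !exprD !exprS.
  ring.
have tel := @telescope_sumr_eq _ 0 n h _ (leq0n n) step.
move: tel; rewrite sumrB -mulr_sumr => /eqP; rewrite subr_eq => /eqP tel.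
rewrite (@big_nat_recr _ _ _ n 0) //= {}tel (@big_nat_recr _ _ _ n.+1 1) //= mulrA.
have -> : theta n.+1 x = theta n x + 2 * ((-1) ^+ n.+1 * x ^+ (n.+1 ^ 2)).
  by rewrite /theta squaresS mulrDr addrA.
(* The boundary term [- h 0] turns the factor 1 - x^(n+1) into 1 + x^(n+1); [h n] and the last
   Shanks term together match the new square in [theta]. *)
rewrite [X in X * _]mulrDl IHn /h /shanks_term !(big_geq (leqnn _)).
rewrite mul1n (@big_nat_recr _ _ _ n.+1 1) //=.
have -> : (n.+1 * n.+2 = n.+1 ^ 2 + n.+1)%N by rewrite mulnS addnC.
rewrite -[(n.+1 * n.+1)%N]/(n.+1 ^ 2)%N !exprD !mulr1.
set Z := \sum_(0 <= i < n) _; move: Z (\prod_(1 <= j < n.+1) (1 - x ^+ j))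
  (\prod_(1 <= j < n.+1) (1 + x ^+ j)) (x ^+ (n.+1 ^ 2)) (x ^+ n.+1) ((-1) ^+ n.+1).
move=> *; ring.
Qed.

(* When x^(n+1) = 0, this is (1 + x) / (1 - x). *)
Definition geom n x : S := 1 + 2 * \sum_(1 <= k < n.+1) x ^+ k.

Lemma sum_expr_mul n x :
  x ^+ n.+1 = 0 -> (1 - x) * (1 + \sum_(1 <= k < n.+1) x ^+ k) = 1.
Proof.
move=> x0; have := subrX1 x n.+1; rewrite x0 -(big_mkord xpredT (GRing.exp x)).
rewrite big_ltn // expr0 => /(congr1 -%R).
by rewrite -mulNr !opprB subr0 => <-.
Qed.

Lemma geom_mul n x : x ^+ n.+1 = 0 -> geom n x * (1 - x) = 1 + x.
Proof.
move=> /sum_expr_mul eq1; rewrite /geom; set y := \sum_(_ <= _ < _) _ in eq1 *.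
transitivity (2 * ((1 - x) * (1 + y)) - (1 - x)); first by ring.
by rewrite eq1; ring.
Qed.

Lemma expr_nilp n x j : x ^+ n.+1 = 0 -> (0 < j)%N -> (x ^+ j) ^+ n.+1 = 0.
Proof. by move=> x0 j0; rewrite exprAC x0 expr0n gtn_eqF. Qed.

(** Gauss' identity: all Shanks terms vanish, and the product of the 1 - x^j is a unit with inverse
    [I], so it can be cancelled. *)
Lemma theta_geom n x : x ^+ n.+1 = 0 ->
  theta n x * \prod_(1 <= j < n.+1) geom n (x ^+ j) = 1.
Proof.
move=> x0.
pose I := \prod_(1 <= j < n.+1) (1 + \sum_(1 <= k < n.+1) (x ^+ j) ^+ k).
pose E := \prod_(1 <= j < n.+1) (1 - x ^+ j).
have EI : E * I = 1.
  rewrite -big_split /= big_nat big1 // => j /andP[j0 _].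
  exact/sum_expr_mul/expr_nilp.
have thetaE : theta n x * \prod_(1 <= j < n.+1) (1 + x ^+ j) = E.
  rewrite theta_mul_prod [\sum_(0 <= s < n) _]big1 ?mulr0 ?addr0 // => s _.
  by rewrite /shanks_term mulnC exprM x0 expr0n mulr0.
have GE : \prod_(1 <= j < n.+1) geom n (x ^+ j) * E
          = \prod_(1 <= j < n.+1) (1 + x ^+ j).
  rewrite -big_split /= big_nat [RHS]big_nat.
  by apply: eq_bigr => j /andP[j0 _]; apply/geom_mul/expr_nilp.
by rewrite -[RHS]EI -[X in _ = X * _]thetaE -GE mulrA -mulrA EI mulr1.
Qed.

Lemma theta_sqr4 n x : 4 = 0 :> S -> theta n x ^+ 2 = 1.
Proof.
move=> h4; rewrite /theta; move: (squares n x) => y.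
have -> : (1 + 2 * y) ^+ 2 = 1 + 4 * (y + y ^+ 2) by ring.
by rewrite h4 mul0r addr0.
Qed.

(** Cross terms come with 2 * 4 = 8, and since 4 = -4 the sign in front of x^(2j^2) is
    immaterial. *)
Lemma squares_sqr n x : 8 = 0 :> S ->
  4 * squares n x ^+ 2 = 4 * squares n (x ^+ 2).
Proof.
move=> h8; elim: n => [|n IHn]; first by rewrite /squares !big_geq // expr0n.
rewrite !squaresS mulrDr -IHn exprAC.
have: ((-1) ^+ n.+1) ^+ 2 = 1 :> S by rewrite sqrr_sign.
move: (squares n x) (x ^+ _) => y t; rewrite -signr_odd.
case: odd => /= _; rewrite ?expr1 ?expr0.
  transitivity (4 * y ^+ 2 + 4 * (-1 * t ^+ 2) + 8 * (t ^+ 2 - y * t)).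
    by ring.
  by rewrite h8 mul0r addr0.
transitivity (4 * y ^+ 2 + 4 * (1 * t ^+ 2) + 8 * (y * t)); first by ring.
by rewrite h8 mul0r addr0.
Qed.

Lemma theta_sqr8 n x : 8 = 0 :> S ->
  theta n x ^+ 2 = 1 + 4 * (squares n x + squares n (x ^+ 2)).
Proof. by move=> h8; rewrite mulrDr -squares_sqr // /theta; ring. Qed.

Lemma expr1D4 (y : S) k : 8 = 0 :> S -> (1 + 4 * y) ^+ k = 1 + 4 * (k%:R * y).
Proof.
move=> h8; elim: k => [|k IHk]; first by rewrite mul0r mulr0 addr0.
rewrite exprS IHk -[k.+1%:R]natr1.
transitivity (1 + 4 * ((k%:R + 1) * y) + 8 * (2 * (k%:R * y * y))); first by ring.
by rewrite h8 mul0r addr0.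
Qed.

Lemma quotient_mod4 n a x G : 4 = 0 :> S -> (0 < a)%N ->
  G * theta n x ^+ (2 * a) = theta n (x ^+ 2) ^+ (2 * a).-1 ->
  G = theta n (x ^+ 2).
Proof.
case: a => // a h4 _; have -> : (2 * a.+1).-1 = (2 * a + 1)%N.
  by rewrite mulnS addn1.
by rewrite exprD !exprM !theta_sqr4 // !expr1n expr1 mulr1 mul1r.
Qed.

(** As phi^4 = 1, the inverse of phi^(2b+1) is phi^(2b+3): the exponents add up to 4(b+1). What
    remains is linear in [squares], so its exponents can be read off. *)
Lemma quotient_mod8 n b x G : 8 = 0 :> S ->
  G * theta n x ^+ (2 * b).+1 = theta n (x ^+ 2) ^+ (2 * b) ->
  G = 1 + 2 * squares n x
      + 4 * (b%:R * (squares n (x ^+ 2) + squares n (x ^+ 4))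
             + b.+1%:R * (squares n x + squares n (x ^+ 2))).
Proof.
move=> h8; rewrite -addn1 => eqG.
have inv : theta n x ^+ (2 * b + 1) * theta n x ^+ (2 * b + 3) = 1.
  rewrite -exprD.
  have -> : (2 * b + 1 + (2 * b + 3) = 2 * (2 * b.+1))%N by lia.
  rewrite exprM theta_sqr8 // expr1D4 //; move: (squares n x + _) => y.
  transitivity (1 + 8 * (b.+1%:R * y)); last by rewrite h8 mul0r addr0.
  by rewrite natrM; ring.
have -> : G = theta n (x ^+ 2) ^+ (2 * b) * theta n x ^+ (2 * b + 3).
  by rewrite -eqG -mulrA inv mulr1.
have -> : (2 * b + 3 = 2 * b.+1 + 1)%N by lia.
rewrite exprD !exprM !theta_sqr8 // !expr1D4 // /theta expr1.
have -> : (x ^+ 2) ^+ 2 = x ^+ 4 by rewrite -exprM.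
set u := squares n x; set v := squares n (x ^+ 2).
set y := _ * (v + _); set z := _ * (u + _); move: u y z => u y z.
transitivity (1 + 2 * u + 4 * (y + z)
              + 8 * (2 * (y * z) + y * u + z * u + 4 * (y * z * u))).
  by ring.
by rewrite h8 mul0r addr0.
Qed.

End Theta.

(** * From overpartitions to the quotient of theta functions *)

Section GeneratingFunction.

Lemma big_is_part (R : comNzRingType) s n (F : nat -> R) : (0 < s)%N ->
  \prod_(u : 'I_n.+1 * 'I_s | is_part u) F u.1 =
  \prod_(1 <= j < n.+1) F j ^+ (if odd j then s else 1).
Proof.
case: s => // s _; rewrite big_mkcond /=.
rewrite -(pair_bigA _ (fun i c => if is_part (i, c) then F i else 1)) /=.
rewrite -(big_mkord xpredT (fun i => \prod_(c < s.+1)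
  (if (0 < i)%N && (odd i || (c == 0 :> nat)) then F i else 1))).
rewrite big_ltn // big1 ?mul1r // big_nat [RHS]big_nat.
apply: eq_bigr => j /andP[-> _] /=; case: odd => /=.
  by rewrite prodr_const card_ord.
by rewrite big_ord_recl big1 ?mulr1.
Qed.

Lemma sum_overlinings (R : comNzRingType) s n
    (m : {ffun 'I_n.+1 * 'I_s -> 'I_n.+1}) :
  \sum_(o : {set 'I_n.+1 * 'I_s} | [forall u in o, 0 < m u]%N) 1 =
  \prod_(u : 'I_n.+1 * 'I_s) (if (m u == 0 :> nat) then 1 else 2) :> R.
Proof.
rewrite sumr_const.
rewrite (eq_card (B := powerset [set u | 0 < m u]%N)); last first.
  move=> o; rewrite !inE; apply/forall_inP/subsetP => h u uo; have := h u uo;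
  by rewrite inE.
rewrite card_powerset natrX -prodr_const [LHS]big_mkcond.
by apply: eq_bigr => u _; rewrite inE lt0n; case: eqP.
Qed.

(** Expanding the product selects a multiplicity for every part; the 2 in [geom] records whether a
    part that occurs is overlined. *)
Lemma abar_coef (R : comNzRingType) s n :
  (abar s n)%:R =
  (\prod_(u : 'I_n.+1 * 'I_s | is_part u) geom n ('X^(u.1) : {poly R}))`_n.
Proof.
(* The weight 0 excludes pairs that are not parts, so that the product runs over all pairs and
   distributes into a sum over all functions [m]. *)
pose c (u : 'I_n.+1 * 'I_s) (k : 'I_n.+1) : R :=
  if (k == 0 :> nat) then 1 else if is_part u then 2 else 0.
have -> : \prod_(u : 'I_n.+1 * 'I_s | is_part u) geom n ('X^(u.1) : {poly R}) =
    \prod_(u : 'I_n.+1 * 'I_s) \sum_(k : 'I_n.+1) (c u k)%:P * 'X^(u.1 * k).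
  rewrite big_mkcond; apply: eq_bigr => u _.
  rewrite big_ord_recl /c /= muln0 expr0 mulr1; case: ifP => _; last first.
    by rewrite big1 ?addr0 // => k _; rewrite mul0r.
  rewrite /geom big_add1 /= big_mkord mulr_sumr; congr (_ + _).
  by apply: eq_bigr => k _; rewrite -exprM polyCMn.
rewrite bigA_distr_bigA coef_sum.
have coefm (m : {ffun 'I_n.+1 * 'I_s -> 'I_n.+1}) :
    (\prod_u ((c u (m u))%:P * 'X^(u.1 * m u)))`_n =
    \sum_(o : {set 'I_n.+1 * 'I_s} | is_overpartition m o) 1.
  rewrite big_split /= -rmorph_prod /= -expr_sum coefCM coefXn eq_sym.
  case: eqP => sum_m; last first.
    by rewrite mulr0 big_pred0 // => o; rewrite /is_overpartition; case: eqP;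
      rewrite ?andbF.
  rewrite mulr1 /is_overpartition.
  case: (boolP [forall u, _]) => [/forallP parts | /forallPn[u]]; last first.
    rewrite negb_imply lt0n => /andP[/negPf mu0 /negPf u_part].
    by rewrite (bigD1 u) //= /c mu0 u_part mul0r big_pred0.
  rewrite sum_m eqxx /=; under [RHS]eq_bigl => o do rewrite andbT.
  rewrite sum_overlinings; apply: eq_bigr => u _; rewrite /c.
  by have := parts u; rewrite lt0n; case: eqP => //= _ ->.
rewrite (eq_bigr _ (fun m _ => coefm m)) pair_big_dep /= sumr_const.
by congr _%:R; apply: eq_card => x; rewrite !inE.
Qed.

Lemma prod_even (R : comNzRingType) n (F : nat -> R) :
  (forall j, (n < j)%N -> F j = 1) ->
  \prod_(1 <= j < n.+1) F (2 * j)%N = \prod_(1 <= j < n.+1 | ~~ odd j) F j.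
Proof.
(* The range is extended to 2n, where even indices are exactly the doubles; the added factors are
   1. *)
move=> F1; transitivity (\prod_(1 <= j < (2 * n).+1 | ~~ odd j) F j).
  elim: n {F1} => [|n IHn]; first by rewrite !big_geq.
  rewrite big_nat_recr //= IHn big_mkcond [RHS]big_mkcond.
  have -> : (2 * n.+1 = (2 * n).+2)%N by lia.
  rewrite (@big_nat_recr _ _ _ (2 * n).+2 1) //
    (@big_nat_recr _ _ _ (2 * n).+1 1) //=.
  by rewrite mul2n odd_double /= mulr1.
rewrite (@big_cat_nat _ _ _ n.+1) //=; last by lia.
by rewrite [X in _ * X]big_nat_cond [X in _ * X]big1 ?mulr1 // =>
  j /andP[/andP[/F1]].
Qed.

Lemma geom_expr_gt (R : comNzRingType) n (x : R) j :
  x ^+ n.+1 = 0 -> (n < j)%N -> geom n (x ^+ j) = 1.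
Proof.
move=> x0 /subnKC <-; rewrite exprD x0 mul0r /geom big_nat big1 ?mulr0 ?addr0 //.
by move=> k /andP[k0 _]; rewrite expr0n gtn_eqF.
Qed.

(** Giving each even part s colours as well multiplies G by [Pe ^+ s.-1] and yields [P ^+ s]. By
    Gauss' identity at x and at x^2, [P] and [Pe] are the inverses of phi(x) and phi(x^2). *)
Lemma generating_function_theta (R : comNzRingType) s n (x : R) :
  x ^+ n.+1 = 0 -> (0 < s)%N ->
  \prod_(1 <= j < n.+1) geom n (x ^+ j) ^+ (if odd j then s else 1)
    * theta n x ^+ s = theta n (x ^+ 2) ^+ s.-1.
Proof.
move=> x0 s0; set G := \prod_(1 <= j < _) _.
pose P := \prod_(1 <= j < n.+1) geom n (x ^+ j).
pose Pe := \prod_(1 <= j < n.+1) geom n (x ^+ (2 * j)).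
have thetaP : theta n x * P = 1 by apply: theta_geom.
have thetaPe : theta n (x ^+ 2) * Pe = 1.
  rewrite -[RHS](@theta_geom _ n (x ^+ 2)) ?expr_nilp //; congr (_ * _).
  by apply: eq_bigr => j _; rewrite exprM.
have GPe : G * Pe ^+ s.-1 = P ^+ s.
  rewrite /Pe (@prod_even _ n (fun j => geom n (x ^+ j))); last first.
    by move=> j; apply: geom_expr_gt.
  rewrite -!prodrXl big_mkcond -big_split /=; apply: eq_bigr => j _.
  by case: odd; rewrite /= ?mulr1 // -exprD add1n prednK.
have -> : G = P ^+ s * theta n (x ^+ 2) ^+ s.-1.
  by rewrite -GPe -mulrA -exprMn [Pe * _]mulrC thetaPe expr1n mulr1.
by rewrite mulrAC -exprMn [P * _]mulrC thetaP expr1n mul1r.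
Qed.

End GeneratingFunction.

(** * Reading off the coefficient of q^n modulo q^(n+1) *)

Section Truncation.
Variable R : comNzRingType.

Lemma rmorph_squares (S T : comNzRingType) (f : {rmorphism S -> T}) n x :
  f (squares n x) = squares n (f x).
Proof.
rewrite rmorph_sum; apply: eq_bigr => j _.
by rewrite rmorphM !rmorphXn rmorphN1.
Qed.

Lemma rmorph_geom (S T : comNzRingType) (f : {rmorphism S -> T}) n x :
  f (geom n x) = geom n (f x).
Proof.
rewrite rmorphD rmorphM rmorph1 rmorph_nat rmorph_sum; congr (_ + _ * _).
by apply: eq_bigr => j _; rewrite rmorphXn.
Qed.

Lemma coef_squares n a N : (forall j, N <> a * j ^ 2)%N ->
  (squares n ('X^a : {poly R}))`_N = 0.
Proof.
move=> NE; rewrite coef_sum big1 // => j _.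
rewrite -exprM -signr_odd; have /eqP/negPf Naj := NE j.
by case: odd; rewrite ?expr0 ?mul1r ?expr1 ?mulN1r ?coefN coefXn Naj ?oppr0.
Qed.

Lemma rmorph_quotient_mod8 (S T : comNzRingType) (f : {rmorphism S -> T}) n b x :
  f (1 + 2 * squares n x
     + 4 * (b%:R * (squares n (x ^+ 2) + squares n (x ^+ 4))
            + b.+1%:R * (squares n x + squares n (x ^+ 2))))
  = 1 + 2 * squares n (f x)
    + 4 * (b%:R * (squares n (f x ^+ 2) + squares n (f x ^+ 4))
           + b.+1%:R * (squares n (f x) + squares n (f x ^+ 2))).
Proof.
rewrite 2!rmorphD 2!rmorphM rmorph1 !rmorph_nat rmorphD 2!rmorphM !rmorph_nat.
by rewrite 2!rmorphD !rmorph_squares !rmorphXn.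
Qed.

(** In this quotient the class of 'X is nilpotent, as Gauss' identity requires, while the
    coefficient of index n survives. *)
Notation trunc n := (@in_qpoly R 'X^(n.+1)).

Lemma coef_trunc n p : (trunc n p)`_n = p`_n.
Proof.
by rewrite /= mk_monic_Xn -Pdiv.RingMonic.take_poly_rmodp coef_take_poly ltnSn.
Qed.

Lemma trunc_expr n : trunc n 'X ^+ n.+1 = 0.
Proof.
rewrite -rmorphXn; apply: val_inj.
by rewrite /= mk_monic_Xn Pdiv.RingMonic.rmodpp ?monicXn.
Qed.

Lemma abar_trunc s n (q : {poly R}) : (0 < s)%N ->
  trunc n (\prod_(1 <= j < n.+1) geom n ('X^j) ^+ (if odd j then s else 1))
    = trunc n q ->
  (abar s n)%:R = q`_n.
Proof.
move=> s0 eq_q.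
rewrite abar_coef (@big_is_part _ s n (fun j => geom n 'X^j)) //.
by rewrite -coef_trunc eq_q coef_trunc.
Qed.

Lemma trunc_nat0 n k :
  k%:R = 0 :> R -> k%:R = 0 :> {poly %/ ('X^(n.+1) : {poly R})}.
Proof.
by move=> k0; rewrite -(rmorph_nat (trunc n)) -(rmorph_nat polyC) k0 !rmorph0.
Qed.

Lemma trunc_generating_function s n : (0 < s)%N ->
  trunc n (\prod_(1 <= j < n.+1) geom n ('X^j) ^+ (if odd j then s else 1))
    * theta n (trunc n 'X) ^+ s = theta n (trunc n 'X ^+ 2) ^+ s.-1.
Proof.
move=> s0; apply: etrans (generating_function_theta (trunc_expr n) s0).
congr (_ * _).
rewrite rmorph_prod; apply: eq_bigr => j _.
by rewrite rmorphXn rmorph_geom rmorphXn.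
Qed.

Lemma abar_mod4 n a : 4 = 0 :> R -> (0 < n)%N -> (0 < a)%N ->
  (forall j, n <> 2 * j ^ 2)%N -> (abar (2 * a) n)%:R = 0 :> R.
Proof.
move=> h4 n0 a0 n2; rewrite (@abar_trunc _ _ (1 + 2 * squares n 'X^2)) ?muln_gt0 //.
  by rewrite coefD coef1 gtn_eqF // mulr_natl coefMn coef_squares // mul0rn addr0.
have := @trunc_generating_function (2 * a) n; rewrite muln_gt0 => /(_ a0).
move/(quotient_mod4 (trunc_nat0 n h4) a0) ->.
by rewrite rmorphD rmorphM rmorph1 rmorph_nat rmorph_squares rmorphXn.
Qed.

Lemma abar_mod8 n b : 8 = 0 :> R -> (0 < n)%N ->
  (forall j, n <> 1 * j ^ 2)%N -> (forall j, n <> 2 * j ^ 2)%N ->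
  (forall j, n <> 4 * j ^ 2)%N -> (abar (2 * b + 1) n)%:R = 0 :> R.
Proof.
move=> h8 n0 n1 n2 n4.
rewrite (@abar_trunc _ _ (1 + 2 * squares n 'X
      + 4 * (b%:R * (squares n 'X^2 + squares n 'X^4)
             + b.+1%:R * (squares n 'X + squares n 'X^2)))) ?addn1 //.
  have sq1 : (squares n ('X : {poly R}))`_n = 0 by rewrite -['X]expr1 coef_squares.
  rewrite !coefD coef1 gtn_eqF // !mulr_natl !(coefMn, coefD) sq1 !coef_squares //.
  by rewrite !(addr0, mul0rn).
have := @trunc_generating_function (2 * b).+1 n isT.
move/(quotient_mod8 (trunc_nat0 n h8)) ->.
exact/esym/rmorph_quotient_mod8.
Qed.

End Truncation.

(** * Valuations and the conclusion *)

Lemma odd_logn_neq p a j n : prime p -> ~~ (p %| a)%N -> odd (logn p n) ->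
  n <> (a * j ^ 2)%N.
Proof.
move=> p_pr pa n_odd n_eq; move: n_odd; rewrite n_eq.
have a0 : (0 < a)%N by case: a pa {n_eq} => //; rewrite dvdn0.
(* For j = 0 the convention [logn p 0 = 0] still gives an even value; otherwise the valuation is
   twice that of j. *)
case: j {n_eq} => [|j]; first by rewrite muln0 logn0.
rewrite lognM ?expn_gt0 // lognX logn_coprime ?prime_coprime //.
by rewrite add0n mul2n odd_double.
Qed.

Lemma modn_eq0_Zp m d : (1 < d)%N -> m%:R = 0 :> 'Z_d -> m = 0 %[mod d].
Proof.
by move=> d1 /(congr1 val) /=; rewrite val_Zp_nat // mod0n.
Qed.

Local Close Scope ring_scope.

Theorem theorem1p7 (p alpha beta : nat)
    (hp : prime p) (hp3 : 3 <= p) (halpha : 1 <= alpha) (hbeta : 1 <= beta) :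
  (abar (2 * alpha) (2 * p) = 0 %[mod 2] ->
   forall n k : nat, ~~ (p %| 2 * n + 1) ->
     abar (2 * alpha) (4 * p ^ (2 * k + 1) * n + 2 * p ^ (2 * k + 1)) = 0 %[mod 4])
  /\
  (abar (2 * beta + 1) (2 * p) = 0 %[mod 2] ->
   forall n k : nat, ~~ (p %| 2 * n + 1) ->
     abar (2 * beta + 1) (4 * p ^ (2 * k + 1) * n + 2 * p ^ (2 * k + 1)) = 0 %[mod 8]).
Proof.
(* The numbers 1, 2 and 4 are the coefficients of j^2 in the exponents to be avoided. *)
have p2 : ~~ (p %| 2) by rewrite gtnNdvd.
have p4 : ~~ (p %| 4) by rewrite -[4]/(2 * 2) Euclid_dvdM // negb_or p2.
have p1 : ~~ (p %| 1) by rewrite dvdn1 gtn_eqF // ltnW.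
have arg n k : 4 * p ^ (2 * k + 1) * n + 2 * p ^ (2 * k + 1) =
    2 * (p ^ (2 * k + 1) * (2 * n + 1)) by nia.
have pos n k : 0 < 2 * (p ^ (2 * k + 1) * (2 * n + 1)).
  by rewrite !muln_gt0 expn_gt0 (prime_gt0 hp) addn_gt0 orbT.
have odd_log n k : ~~ (p %| 2 * n + 1) ->
    odd (logn p (2 * (p ^ (2 * k + 1) * (2 * n + 1)))).
  move=> pn; have := pos n k; rewrite muln_gt0 => /andP[_ pos'].
  move: (pos'); rewrite muln_gt0 => /andP[pk n1].
  (* Both 2 and 2n+1 are prime to p, so the valuation is 2k+1. *)
  rewrite !lognM // pfactorK // !logn_coprime ?prime_coprime //.
  by rewrite add0n addn0 oddD mul2n odd_double.
split=> _ n k pn; rewrite arg; apply: modn_eq0_Zp => //.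
  apply: abar_mod4 => //; first exact: char_Zp.
  by move=> j; apply: odd_logn_neq (odd_log n k pn).
apply: abar_mod8 => //; first exact: char_Zp.
- by move=> j; apply: odd_logn_neq (odd_log n k pn).
- by move=> j; apply: odd_logn_neq (odd_log n k pn).
- by move=> j; apply: odd_logn_neq (odd_log n k pn).
Qed.
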